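(* Let $A=(A,\alpha,\prec,\succ)$ be a multiplicative hom-dendriform algebra over $\mathbb{K}$. If $H^2_{\alpha,\mathrm{Dend}}(A,A)=0$, then every (formal) deformation of $A$ is equivalent to a trivial deformation.
   Context: $\mathbb{K}$ is a field of characteristic zero; all spaces and maps are over $\mathbb{K}$. A multiplicative hom-dendriform algebra $(A,\alpha,\prec,\succ)$ is a vector space (or module over a commutative ring) $A$ with a linear map $\alpha:A\to A$ and bilinear operations $\prec,\succ$ on $A$ such that for all $a,b,c\in A$: $(a\prec b)\prec\alpha(c)=\alpha(a)\prec(b\prec c+b\succ c)$; $(a\succ b)\prec\alpha(c)=\alpha(a)\succ(b\prec c)$; $(a\prec b+a\succ b)\succ\alpha(c)=\alpha(a)\succ(b\succ c)$; and $\alpha(a\prec b)=\alpha(a)\prec\alpha(b)$, $\alpha(a\succ b)=\alpha(a)\succ\alpha(b)$. Cohomology. Let $C_n=\{[1],\dots,[n]\}$ and let $\mathbb{K}[C_n]$ be the vector space with basis $C_n$. For $m,n\ge1$, $1\le i\le m$, define maps $R_0=R_0(m;1,\dots,n,\dots,1):C_{m+n-1}\to C_m$ and $R_i=R_i(m;1,\dots,n,\dots,1):C_{m+n-1}\to\mathbb{K}[C_n]$ (with $n$ in the $i$-th place) by: $R_0[r]=[r]$ if $r\le i-1$, $R_0[r]=[i]$ if $i\le r\le i+n-1$, $R_0[r]=[r-n+1]$ if $i+n\le r\le m+n-1$; and $R_i[r]=[r-(i-1)]$ if $i\le r\le i+n-1$, $R_i[r]=[1]+\cdots+[n]$ otherwise.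 For $n\ge1$, $C^n_{\alpha,\mathrm{Dend}}(A,A)$ is the space of linear maps $f:\mathbb{K}[C_n]\otimes A^{\otimes n}\to A$ with $\alpha(f([r];a_1,\dots,a_n))=f([r];\alpha(a_1),\dots,\alpha(a_n))$ for all $[r]\in C_n$; $C^0_{\alpha,\mathrm{Dend}}(A,A)=0$. For $f$ of arity $m$, $g$ of arity $n$, $1\le i\le m$: $$(f\bullet_i g)([r];a_1,\dots,a_{m+n-1})=f\big(R_0[r];\alpha^{n-1}a_1,\dots,\alpha^{n-1}a_{i-1},g(R_i[r];a_i,\dots,a_{i+n-1}),\alpha^{n-1}a_{i+n},\dots,\alpha^{n-1}a_{m+n-1}\big),$$ and $f\bullet g=\sum_{i=1}^m(-1)^{(i-1)(n-1)}f\bullet_i g$. Let $\pi([1];a,b)=a\prec b$, $\pi([2];a,b)=a\succ b$. The differential is $\delta_{\alpha,\mathrm{Dend}}(f)=\pi\bullet f-(-1)^{n-1}f\bullet\pi$ for $f\in C^n_{\alpha,\mathrm{Dend}}(A,A)$, and $H^n_{\alpha,\mathrm{Dend}}(A,A)$ is its cohomology. Deformations. A (formal) deformation of $A$ consists of formal power series $\prec_t=\sum_{i\ge0}\prec_it^i$, $\succ_t=\sum_{i\ge0}\succ_it^i$ of bilinear maps on $A$ with $\prec_0=\prec$, $\succ_0=\succ$, such that $(A[[t]],\alpha,\prec_t,\succ_t)$ is a multiplicative hom-dendriform algebra over $\mathbb{K}[[t]]$ ($\alpha$ and all the maps extended $\mathbb{K}[[t]]$-linearly to power series). Two deformations $(\prec_t,\succ_t)$,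 $(\prec_t',\succ_t')$ are equivalent if there is a formal isomorphism $\Phi_t=\sum_{i\ge0}\Phi_it^i:A[[t]]\to A[[t]]$, with each $\Phi_i:A\to A$ linear and commuting with $\alpha$, $\Phi_0=\mathrm{id}_A$, such that $\Phi_t(a\prec_tb)=\Phi_t(a)\prec_t'\Phi_t(b)$ and $\Phi_t(a\succ_tb)=\Phi_t(a)\succ_t'\Phi_t(b)$. A deformation is trivial if it is equivalent to the constant deformation $(\prec_t'=\prec,\succ_t'=\succ)$. *)

(* Defs.v *)
From HB Require Import structures.
From mathcomp Require Import all_boot all_order all_algebra.
From mathcomp Require Import boolp functions.

Set Implicit Arguments.
Unset Strict Implicit.
Unset Printing Implicit Defensive.

Import GRing.Theory.
Local Open Scope ring_scope.

(* Stated over a commutative ring, so as to apply both to A over a field K and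
   to A[[t]] over K[[t]]. *)
Record hom_dendriform (R : comNzRingType) (V : lmodType R) (alpha : V -> V)
    (prec succ : V -> V -> V) : Prop := HomDendriform {
  hd_alpha_linear : linear alpha;
  hd_prec_bilinear : bilinear_for *:%R *:%R prec;
  hd_succ_bilinear : bilinear_for *:%R *:%R succ;
  hd_prec_prec : forall a b c,
    prec (prec a b) (alpha c) = prec (alpha a) (prec b c + succ b c);
  hd_succ_prec : forall a b c,
    prec (succ a b) (alpha c) = succ (alpha a) (prec b c);
  hd_succ_succ : forall a b c,
    succ (prec a b + succ a b) (alpha c) = succ (alpha a) (succ b c);
  hd_alpha_prec : forall a b, alpha (prec a b) = prec (alpha a) (alpha b);
  hd_alpha_succ : forall a b, alpha (succ a b) = succ (alpha a) (alpha b)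
}.

Section Cohomology.
Variables (K : fieldType) (A : lmodType K).

(* K[C_n] is 'rV[K]_n, the basis element [r+1] being delta_mx 0 r (indices are
   shifted by one throughout: r ranges over 0, ..., n-1), and a linear map
   K[C_n] (x) A^(x)n -> A is a function linear in its first argument and
   multilinear in the n vectors of the second one. *)
Definition cmap (n : nat) := 'rV[K]_n -> {ffun 'I_n -> A} -> A.

Definition multilinear_cmap (n : nat) (f : cmap n) : Prop :=
  (forall a, linear (f^~ a)) /\
  (forall e a (j : 'I_n),
     linear (fun x => f e [ffun k => if k == j then x else a k])).

(* For n = 0 only the zero map qualifies, since K[C_0] = 0. *)
Definition is_cochain (alpha : A -> A) (n : nat) (f : cmap n) : Prop :=
  multilinear_cmap f /\
  (forall (r : 'I_n) a,
     alpha (f (delta_mx 0 r) a) = f (delta_mx 0 r) [ffun k => alpha (a k)]).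

(* In what follows f has arity m.+1 and g has arity n.+1, so that f o_i g has
   arity (m + n).+1; every [inord] below is applied to an index in range. *)
Definition R0 (m n : nat) (i : 'I_m.+1) (r : 'I_(m + n).+1) : 'I_m.+1 :=
  inord (if r < i then r : nat else if r < i + n.+1 then i : nat else r - n)%N.

Definition Ri (m n : nat) (i : 'I_m.+1) (r : 'I_(m + n).+1) : 'rV[K]_n.+1 :=
  if (i <= r < i + n.+1)%N then delta_mx 0 (inord (r - i))
  else \sum_(s < n.+1) delta_mx 0 s.

Definition circ_i (alpha : A -> A) (m n : nat) (i : 'I_m.+1)
    (f : cmap m.+1) (g : cmap n.+1) : cmap (m + n).+1 :=
  fun e a => \sum_(r < (m + n).+1) e 0 r *:
    f (delta_mx 0 (R0 i r))
      [ffun j : 'I_m.+1 =>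
         if (j < i)%N then iter n alpha (a (inord j))
         else if j == i then
           g (Ri i r) [ffun k : 'I_n.+1 => a (inord (i + k))]
         else iter n alpha (a (inord (j + n)))].

Definition circ (alpha : A -> A) (m n : nat)
    (f : cmap m.+1) (g : cmap n.+1) : cmap (m + n).+1 :=
  fun e a => \sum_(i < m.+1) (-1) ^+ (i * n) *: circ_i alpha i f g e a.

Definition pi_cmap (prec succ : A -> A -> A) : cmap 2 :=
  fun e a => e 0 ord0 *: prec (a ord0) (a ord_max)
           + e 0 ord_max *: succ (a ord0) (a ord_max).

Definition differential (alpha : A -> A) (prec succ : A -> A -> A) (n : nat) :
    cmap n -> cmap n.+1 :=
  match n with
  | 0 => fun _ _ _ => 0
  | k.+1 => fun f e a =>
      circ alpha (pi_cmap prec succ) f e a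
      - (-1) ^+ k *: (ecast p (cmap p.+1) (addn1 k)
                        (circ alpha f (pi_cmap prec succ))) e a
  end.

Definition is_cocycle (alpha : A -> A) (prec succ : A -> A -> A) (n : nat)
    (f : cmap n) : Prop :=
  is_cochain alpha f /\ forall e a, differential alpha prec succ f e a = 0.

Definition is_coboundary (alpha : A -> A) (prec succ : A -> A -> A) (n : nat) :
    cmap n -> Prop :=
  match n with
  | 0 => fun f => forall e a, f e a = 0
  | k.+1 => fun f => exists2 g : cmap k, is_cochain alpha g &
      forall e a, f e a = differential alpha prec succ g e a
  end.

(* H^n = Z^n / B^n is the zero space. *)
Definition cohomology_eq0 (alpha : A -> A) (prec succ : A -> A -> A) (n : nat) :
    Prop :=
  forall f : cmap n, is_cocycle alpha prec succ f ->
    is_coboundary alpha prec succ f.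

End Cohomology.

(* Formal power series: fps R is the ring R[[t]] and, for an R-module V, fps V
   is the R[[t]]-module V[[t]]. The addition is the pointwise one of nat -> V. *)
Definition fps (T : Type) := nat -> T.

HB.instance Definition _ (V : zmodType) := GRing.Zmodule.copy (fps V) (nat -> V).

Section FpsScale.
Variables (R : comNzRingType) (V : lmodType R).

Definition fps_scale (p : fps R) (v : fps V) : fps V :=
  fun n => \sum_(i < n.+1) p i *: v (n - i)%N.

End FpsScale.

Section FpsRing.
Variable R : comNzRingType.
Implicit Types p q : fps R.

Definition fps_mul p q : fps R := fun n => \sum_(i < n.+1) p i * q (n - i)%N.

Definition fps_one : fps R := fun n => (n == 0)%:R.

Lemma fps_addE (W : zmodType) (u v : fps W) n : (u + v) n = u n + v n.
Proof. by []. Qed.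

Lemma fps_mul_trunc p q n k : (n <= k)%N ->
  fps_mul p q n = ((\poly_(i < k.+1) p i) * (\poly_(i < k.+1) q i))`_n.
Proof.
move=> nk; rewrite coefM; apply: eq_bigr => i _.
rewrite !coef_poly !ifT //.
- by rewrite ltnS (leq_trans (leq_subr _ _)).
- by rewrite ltnS (leq_trans _ nk) // -ltnS.
Qed.

Lemma fps_mulC : commutative fps_mul.
Proof. by move=> p q; apply/funext => n; rewrite !(fps_mul_trunc _ _ (leqnn n)) mulrC. Qed.

Lemma fps_mul1 : left_id fps_one fps_mul.
Proof.
move=> p; apply/funext => n; rewrite /fps_mul big_ord_recl /= /fps_one eqxx mul1r subn0.
by rewrite big1 ?addr0 // => i _; rewrite /= mul0r.
Qed.

Lemma fps_mulDl : left_distributive fps_mul +%R.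
Proof.
move=> p q r; apply/funext => n; rewrite fps_addE /fps_mul -big_split /=.
by apply: eq_bigr => i _; rewrite fps_addE mulrDl.
Qed.

End FpsRing.

Section FpsModule.
Variables (R : comNzRingType) (V : lmodType R).
Implicit Types (p q : fps R) (u v : fps V).

Lemma fps_scaleA p q v : fps_scale p (fps_scale q v) = fps_scale (fps_mul p q) v.
Proof.
apply/funext => n; rewrite /fps_scale /fps_mul.
under eq_bigr => i _ do rewrite scaler_sumr.
under [RHS]eq_bigr => i _ do rewrite scaler_suml.
rewrite (eq_bigr (fun i : 'I_n.+1 => \sum_(k < n.+1 | (i <= k)%N)
    (p i * q (k - i)%N) *: v (n - k)%N)); last first.
  move=> i _; have iln : (i <= n)%N by rewrite -ltnS.
  rewrite -(big_mkord (fun j => true)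
    (fun j => p i *: (q j *: v (n - i - j)%N))).
  rewrite -(big_mkord (fun k => (i <= k)%N)
    (fun k => (p i * q (k - i)%N) *: v (n - k)%N)).
  rewrite [RHS](big_cat_nat (n := i)) //=; last exact: leqW.
  rewrite [X in _ = X + _]big_nat_cond [X in _ = X + _]big1 ?add0r; last first.
    by move=> k /andP[/= ki ik]; move: ki; rewrite ltnNge ik.
  have := @big_addn _ 0 +%R 0%N n.+1 i (fun k => (i <= k)%N)
    (fun k => (p i * q (k - i)%N) *: v (n - k)%N).
  rewrite add0n subSn // => ->.
  rewrite [RHS]big_mkcond /=; apply: eq_bigr => j _.
  by rewrite leq_addl addnK scalerA addnC subnDA.
rewrite (exchange_big_dep predT) //=; apply: eq_bigr => k _.
rewrite -(big_mkord (fun i => (i <= k)%N)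
  (fun i => (p i * q (k - i)%N) *: v (n - k)%N)).
rewrite (big_cat_nat (n := k.+1)) //= [X in _ + X]big_nat_cond.
rewrite [X in _ + X]big1 ?addr0; last first.
  by move=> i /andP[/andP[ki _] ik]; move: ki; rewrite ltnNge ik.
rewrite -(big_mkord predT (fun i => (p i * q (k - i)%N) *: v (n - k)%N)).
rewrite big_nat_cond [RHS]big_nat_cond; apply: eq_bigl => i.
by rewrite ltnS; case: (i <= k)%N; rewrite ?andbF.
Qed.

Lemma fps_scale1 v : fps_scale (fps_one R) v = v.
Proof.
apply/funext => n; rewrite /fps_scale big_ord_recl /= /fps_one eqxx scale1r subn0.
by rewrite big1 ?addr0 // => i _; rewrite /= scale0r.
Qed.

Lemma fps_scaleDr p u v : fps_scale p (u + v) = fps_scale p u + fps_scale p v.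
Proof.
apply/funext => n; rewrite fps_addE /fps_scale -big_split /=.
by apply: eq_bigr => i _; rewrite fps_addE scalerDr.
Qed.

Lemma fps_scaleDl p q v : fps_scale (p + q) v = fps_scale p v + fps_scale q v.
Proof.
apply/funext => n; rewrite fps_addE /fps_scale -big_split /=.
by apply: eq_bigr => i _; rewrite fps_addE scalerDl.
Qed.

End FpsModule.

Section FpsInstances.
Variable R : comNzRingType.

Lemma fps_mulA : associative (@fps_mul R).
Proof. by move=> p q r; exact: (@fps_scaleA R R^o p q r). Qed.

Lemma fps_one_neq0 : fps_one R != 0.
Proof.
by apply/eqP => /(congr1 (fun p : fps R => p 0%N)) /eqP; rewrite /fps_one /= oner_eq0.
Qed.

HB.instance Definition _ := GRing.Zmodule_isComNzRing.Build (fps R)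
  fps_mulA (@fps_mulC R) (@fps_mul1 R) (@fps_mulDl R) fps_one_neq0.

HB.instance Definition _ (V : lmodType R) :=
  GRing.Zmodule_isLmodule.Build (fps R) (fps V)
    (@fps_scaleA R V) (@fps_scale1 R V) (fun p u v => fps_scaleDr p u v)
    (fun v p q => fps_scaleDl p q v).

End FpsInstances.

Section Deformation.
Variables (K : fieldType) (A : lmodType K).

(* K[[t]]-linear extensions to A[[t]] of a linear map, of a power series of
   linear maps, and of a power series of bilinear maps. *)
Definition ext_const (alpha : A -> A) : fps A -> fps A :=
  fun a n => alpha (a n).

Definition ext_lin (Phi : fps (A -> A)) : fps A -> fps A :=
  fun a n => \sum_(i < n.+1) Phi i (a (n - i)%N).

Definition ext_bilin (mu : fps (A -> A -> A)) : fps A -> fps A -> fps A :=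
  fun a b n => \sum_(i < n.+1) \sum_(j < (n - i).+1)
    mu i (a j) (b (n - i - j)%N).

Definition is_deformation (alpha : A -> A) (prec succ : A -> A -> A)
    (prec_t succ_t : fps (A -> A -> A)) : Prop :=
  [/\ forall i, bilinear_for *:%R *:%R (prec_t i),
      forall i, bilinear_for *:%R *:%R (succ_t i),
      prec_t 0%N = prec, succ_t 0%N = succ &
      @hom_dendriform (fps K) (fps A) (ext_const alpha)
        (ext_bilin prec_t) (ext_bilin succ_t)].

Definition equivalent_deformations (alpha : A -> A)
    (prec_t succ_t prec_t' succ_t' : fps (A -> A -> A)) : Prop :=
  exists Phi : fps (A -> A),
    [/\ forall i, linear (Phi i) /\ (forall a, Phi i (alpha a) = alpha (Phi i a)),
        Phi 0%N = id,
        bijective (ext_lin Phi),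
        forall a b, ext_lin Phi (ext_bilin prec_t a b)
          = ext_bilin prec_t' (ext_lin Phi a) (ext_lin Phi b) &
        forall a b, ext_lin Phi (ext_bilin succ_t a b)
          = ext_bilin succ_t' (ext_lin Phi a) (ext_lin Phi b)].

Definition const_fps (mu : A -> A -> A) : fps (A -> A -> A) :=
  fun i => if i is 0 then mu else fun _ _ => 0.

Definition trivial_deformation (alpha : A -> A) (prec succ : A -> A -> A)
    (prec_t succ_t : fps (A -> A -> A)) : Prop :=
  equivalent_deformations alpha prec_t succ_t (const_fps prec) (const_fps succ).

End Deformation.

(* Main.v *)
(* An isomorphism Phi from (prec_t, succ_t) to the constant deformation is built
   one coefficient at a time. If Phi_0, ..., Phi_(n-1) make Phi multiplicative
   modulo t^n, then the coefficient of t^n of the failure of multiplicativity is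
   a 2-cocycle: applying Phi to the hom-dendriform relations of the deformation
   and reading off t^n, everything cancels except the linearized relations. Since
   H^2 = 0 this cocycle is the coboundary of some phi, and Phi_n := phi makes Phi
   multiplicative modulo t^(n+1). Hence the deformation is itself trivial. *)
Require Import Defs.
From mathcomp Require Import all_boot all_order all_algebra.
From mathcomp Require Import boolp functions.

Set Implicit Arguments.
Unset Strict Implicit.
Unset Printing Implicit Defensive.

Import GRing.Theory.
Local Open Scope ring_scope.

(** * Linear maps given as plain functions *)

Section LinearMaps.
Variables (K : fieldType) (A B : lmodType K) (f : A -> B).
Hypothesis f_lin : linear f.

Lemma linear_fun_add u v : f (u + v) = f u + f v.
Proof. by have := f_lin 1 u v; rewrite !scale1r. Qed.

Lemma linear_fun0 : f 0 = 0.
Proof. by apply: (addIr (f 0)); rewrite -linear_fun_add !add0r. Qed.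

Lemma linear_fun_sum (I : Type) (r : seq I) (F : I -> A) :
  f (\sum_(i <- r) F i) = \sum_(i <- r) f (F i).
Proof. exact: (big_morph f linear_fun_add linear_fun0). Qed.

End LinearMaps.

Lemma linear_sum_fun (K : fieldType) (A B : lmodType K) (I : Type) (r : seq I)
    (F : I -> A -> B) :
  (forall i, linear (F i)) -> linear (fun x => \sum_(i <- r) F i x).
Proof.
move=> F_lin c u v; rewrite scaler_sumr -big_split /=.
by apply: eq_bigr => i _; rewrite F_lin.
Qed.

Lemma linear_sub_fun (K : fieldType) (A B : lmodType K) (f g : A -> B) :
  linear f -> linear g -> linear (fun x => f x - g x).
Proof.
by move=> f_lin g_lin c u v; rewrite f_lin g_lin scalerBr opprD addrACA.
Qed.

(** * Reindexing of double sums over a triangle *)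

Section TriangularSums.
Variable V : nmodType.

(** Regrouping by the total degree [m = p + i]: passing from [N] to [N.+1] adds the antidiagonal
    [p + i = N.+1] on either side. This is what reassociates nested Cauchy products below. *)
Lemma sum_triangle (F : nat -> nat -> V) N :
  \sum_(p < N.+1) \sum_(i < (N - p).+1) F p i
  = \sum_(m < N.+1) \sum_(p < m.+1) F p (m - p)%N.
Proof.
elim: N => [|N IHN]; first by rewrite !big_ord1.
rewrite [RHS]big_ord_recr -IHN [LHS]big_ord_recr /= subnn big_ord1.
rewrite [X in _ = _ + X]big_ord_recr /= subnn addrA; congr (_ + _).
rewrite -big_split /=; apply: eq_bigr => p _.
by rewrite subSn ?leq_ord // big_ord_recr.
Qed.

Lemma sum_triangle_swap (F : nat -> nat -> V) N :
  \sum_(p < N.+1) \sum_(i < (N - p).+1) F p i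
  = \sum_(i < N.+1) \sum_(p < (N - i).+1) F p i.
Proof.
rewrite sum_triangle (sum_triangle (fun i p => F p i)).
apply: eq_bigr => m _; rewrite (reindex_inj rev_ord_inj) /=.
by apply: eq_bigr => p _; rewrite subSS subKn ?leq_ord.
Qed.

End TriangularSums.

(** * Building a sequence term by term with dependent choice *)

Section RecursiveChoice.
Variables (T : Type) (x0 : T).

Definition update (s : nat -> T) (n : nat) (x : T) : nat -> T :=
  fun k => if k == n then x else s k.

Variable P : nat -> (nat -> T) -> Prop.
Hypothesis P_local : forall n s s',
  (forall k, (k <= n)%N -> s k = s' k) -> P n s -> P n s'.
Hypothesis P_extend : forall n s,
  (forall k, (k < n)%N -> P k s) -> exists x, P n (update s n x).

(** Terms are chosen one after the other; by [P_local], a condition once achieved at stage [n] is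
    not disturbed by the choice of later terms. It serves both to invert a power series of maps and
    to construct the equivalence. *)
Lemma recursive_choice : exists s, forall n, P n s.
Proof.
(* The premise is placed under the existential so that [choice] yields a function [g] total on all
   pairs; [x0] is its value where the premise fails. *)
have /choice[g gP] (ns : nat * (nat -> T)) : exists x,
    (forall k, (k < ns.1)%N -> P k ns.2) -> P ns.1 (update ns.2 ns.1 x).
  have [H|H] := pselect (forall k, (k < ns.1)%N -> P k ns.2); last by exists x0.
  by have [x Px] := P_extend H; exists x.
(* [S n] holds the first [n] chosen terms, followed by [x0]. *)
pose S := fix S n := if n is m.+1 then update (S m) m (g (m, S m)) else fun=> x0.
have S_stable n k : (k < n)%N -> S n k = S k.+1 k.
  elim: n => [//|n IHn]; rewrite ltnS leq_eqVlt => /orP[/eqP->//|kn].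
  by rewrite /= {1}/update ltn_eqF // IHn.
have S_good n k : (k < n)%N -> P k (S n).
  elim: n k => [//|n IHn] k; rewrite ltnS leq_eqVlt => /orP[/eqP->|kn].
    exact: (gP (n, S n)).
  apply: P_local (IHn k kn) => j jk.
  by rewrite /= /update ltn_eqF // (leq_ltn_trans jk).
(* The term of index [n] is settled from stage [n.+1] on, so the diagonal agrees with [S n.+1] up to
   index [n]. *)
exists (fun n => S n.+1 n) => n.
by apply: P_local (S_good n.+1 n (ltnSn n)) => k kn; rewrite S_stable.
Qed.

End RecursiveChoice.

(** * Power series of linear and bilinear maps acting on A[[t]] *)

Section PowerSeries.
Variables (K : fieldType) (A : lmodType K).
Implicit Types (mu nu : fps (A -> A -> A)) (Phi : fps (A -> A)) (x y z : fps A).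

Definition fps_const (a : A) : fps A := fun n => if n is 0 then a else 0.

Definition bilinear_fps mu := forall i, bilinear_for *:%R *:%R (mu i).

Definition linear_fps Phi := forall i, linear (Phi i).

Lemma bilinear_fps_add mu nu :
  bilinear_fps mu -> bilinear_fps nu -> bilinear_fps (mu + nu).
Proof.
move=> mu_bilin nu_bilin i; split=> u c v w; rewrite !fps_addE /=.
  by rewrite !fctE (mu_bilin i).1 (nu_bilin i).1 scalerDr addrACA.
by rewrite !fctE (mu_bilin i).2 (nu_bilin i).2 scalerDr addrACA.
Qed.

Lemma ext_bilinD mu nu x y :
  ext_bilin (mu + nu) x y = ext_bilin mu x y + ext_bilin nu x y.
Proof.
apply/funext => n; rewrite fps_addE /ext_bilin -big_split; apply: eq_bigr => i _.
by rewrite -big_split.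
Qed.

Lemma ext_bilin_constE (m : A -> A -> A) x y n :
  ext_bilin (const_fps m) x y n = \sum_(j < n.+1) m (x j) (y (n - j)%N).
Proof.
rewrite /ext_bilin big_ord_recl /= subn0 [X in _ + X]big1 ?addr0 // => i _.
by rewrite big1.
Qed.

(** An operation of order at least [n] uses up all of the degree [n], so its arguments enter only
    through their constant terms. This is how linearized relations are read off the coefficient of
    t^n. *)
Lemma ext_bilin_leading mu n x y : (forall k, (k < n)%N -> mu k = fun _ _ => 0) ->
  ext_bilin mu x y n = mu n (x 0%N) (y 0%N).
Proof.
move=> mu0; rewrite /ext_bilin big_ord_recr /= subnn big_ord1 subn0 big1 ?add0r //.
by move=> i _; rewrite big1 // => j _; rewrite mu0.
Qed.

Lemma ext_bilin_lt mu n x y : (forall k, (k < n)%N -> mu k = fun _ _ => 0) ->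
  forall k, (k < n)%N -> ext_bilin mu x y k = 0.
Proof.
move=> mu0 k kn; rewrite ext_bilin_leading ?mu0 // => j jk.
by rewrite mu0 // (ltn_trans jk).
Qed.

Lemma ext_bilin_fps_const mu a b n : bilinear_fps mu ->
  ext_bilin mu (fps_const a) (fps_const b) n = mu n a b.
Proof.
move=> mu_bilin; rewrite /ext_bilin big_ord_recr /= subnn big_ord1 big1 ?add0r //.
move=> i _; rewrite big1 // => -[[|j] ?] _ /=; last first.
  by rewrite (linear_fun0 ((mu_bilin i).1 _)).
by rewrite subn0; case: (n - i)%N (subn_gt0 i n); rewrite ?ltn_ord //= => *;
  rewrite (linear_fun0 ((mu_bilin i).2 _)).
Qed.

Section ConstantOperation.
Variable m : A -> A -> A.
Hypothesis m_bilin : bilinear_for *:%R *:%R m.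

Lemma ext_bilin_constDl x y z :
  ext_bilin (const_fps m) (x + y) z
  = ext_bilin (const_fps m) x z + ext_bilin (const_fps m) y z.
Proof.
apply/funext => n; rewrite fps_addE !ext_bilin_constE -big_split.
by apply: eq_bigr => i _; rewrite fps_addE (linear_fun_add (m_bilin.1 _)).
Qed.

Lemma ext_bilin_constDr x y z :
  ext_bilin (const_fps m) x (y + z)
  = ext_bilin (const_fps m) x y + ext_bilin (const_fps m) x z.
Proof.
apply/funext => n; rewrite fps_addE !ext_bilin_constE -big_split.
by apply: eq_bigr => i _; rewrite fps_addE (linear_fun_add (m_bilin.2 _)).
Qed.

Lemma ext_bilin_const_leadingl n x y : (forall k, (k < n)%N -> x k = 0) ->
  ext_bilin (const_fps m) x y n = m (x n) (y 0%N).
Proof.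
move=> x0; rewrite ext_bilin_constE big_ord_recr /= subnn big1 ?add0r // => i _.
by rewrite x0 // (linear_fun0 (m_bilin.1 _)).
Qed.

Lemma ext_bilin_const_leadingr n x y : (forall k, (k < n)%N -> y k = 0) ->
  ext_bilin (const_fps m) x y n = m (x 0%N) (y n).
Proof.
move=> y0; rewrite ext_bilin_constE big_ord_recl /= subn0 big1 ?addr0 // => i _.
by rewrite y0 ?(linear_fun0 (m_bilin.2 _)) // ltn_subrL
  (leq_ltn_trans _ (ltn_ord i)).
Qed.

End ConstantOperation.

(** All three hom-dendriform axioms have this shape, with [m2] or [m4] possibly the sum of the two
    operations. Both sides expand over pairs [i + k <= n], the remaining degree going to [z], and
    agree term by term. *)
Lemma ext_const_hom_assoc (alpha : A -> A) (m1 m2 m3 m4 : A -> A -> A) x y z :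
    bilinear_for *:%R *:%R m1 -> bilinear_for *:%R *:%R m3 ->
    (forall a b c, m1 (m2 a b) (alpha c) = m3 (alpha a) (m4 b c)) ->
  ext_bilin (const_fps m1) (ext_bilin (const_fps m2) x y) (ext_const alpha z)
  = ext_bilin (const_fps m3) (ext_const alpha x) (ext_bilin (const_fps m4) y z).
Proof.
move=> m1_bilin m3_bilin assoc; apply/funext => n; rewrite !ext_bilin_constE.
pose F i k := m1 (m2 (x i) (y k)) (alpha (z (n - (i + k))%N)).
transitivity (\sum_(j < n.+1) \sum_(i < j.+1) F i (j - i)%N).
  apply: eq_bigr => j _; rewrite ext_bilin_constE (linear_fun_sum (m1_bilin.1 _)).
  by apply: eq_bigr => i _; rewrite /F subnKC ?leq_ord.
rewrite -sum_triangle; apply: eq_bigr => i _.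
rewrite ext_bilin_constE (linear_fun_sum (m3_bilin.2 _)).
by apply: eq_bigr => k _; rewrite /F assoc subnDA.
Qed.

Lemma ext_lin_const Phi (alpha : A -> A) x : linear alpha ->
    (forall i a, Phi i (alpha a) = alpha (Phi i a)) ->
  ext_lin Phi (ext_const alpha x) = ext_const alpha (ext_lin Phi x).
Proof.
move=> alpha_lin Phi_alpha; apply/funext => n.
rewrite /ext_const /ext_lin linear_fun_sum //.
by apply: eq_bigr => i _; rewrite Phi_alpha.
Qed.

(** Since [Phi 0 = id], the system is unitriangular: coefficient [n] of the image is [x n] plus
    terms in strictly lower coefficients of [x]. Strong induction gives injectivity, and solving for
    [x n] recursively gives surjectivity. *)
Lemma ext_lin_bijective Phi : linear_fps Phi -> Phi 0%N = id ->
  bijective (ext_lin Phi).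
Proof.
move=> Phi_lin Phi0.
have ext_linS x n : ext_lin Phi x n = x n + \sum_(i < n) Phi i.+1 (x (n - i.+1)%N).
  by rewrite /ext_lin big_ord_recl Phi0 subn0.
have inj : injective (ext_lin Phi).
  move=> x y xy; apply/funext => n; have [N] := ubnP n.
  elim: N n => // N IHN n; rewrite ltnS => nN.
  have := congr1 (fun u : fps A => u n) xy; rewrite !ext_linS.
  rewrite [X in _ = _ + X](eq_bigr (fun i : 'I_n => Phi i.+1 (x (n - i.+1)%N))).
    by move/addIr.
  move=> i _; rewrite IHN // (leq_trans _ nN) // ltn_subrL /=.
  exact: leq_ltn_trans (ltn_ord i).
have surj y : exists x, ext_lin Phi x = y.
  have [|n s _|s sP] := @recursive_choice A 0 (fun n s => ext_lin Phi s n = y n).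
  - move=> n s s' ss' <-; rewrite !ext_linS ss' //; congr (_ + _).
    by apply: eq_bigr => i _; rewrite ss' // leq_subr.
  - exists (y n - \sum_(i < n) Phi i.+1 (s (n - i.+1)%N)).
    rewrite ext_linS {1}/update eqxx -[RHS]addr0 -addrA; congr (_ + _).
    apply/eqP; rewrite addrC subr_eq0; apply/eqP.
    apply: eq_bigr => i _; rewrite /update ltn_eqF // ltn_subrL /=.
    exact: leq_ltn_trans (ltn_ord i).
  by exists s; apply/funext.
have [g gK] := choice surj.
by exists g => // x; apply: inj; rewrite gK.
Qed.

(* The coefficients of Phi (x mu y) - (Phi x) mu_0 (Phi y). *)
Definition defect Phi mu : fps (A -> A -> A) := fun n a b =>
  \sum_(i < n.+1) Phi i (mu (n - i)%N a b)
  - \sum_(i < n.+1) mu 0%N (Phi i a) (Phi (n - i)%N b).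

Lemma eq_defect Phi Phi' mu n : (forall k, (k <= n)%N -> Phi k = Phi' k) ->
  defect Phi mu n = defect Phi' mu n.
Proof.
move=> eqPhi; apply/funext => a; apply/funext => b; rewrite /defect.
by congr (_ - _); apply: eq_bigr => i _; rewrite !eqPhi ?leq_ord ?leq_subr.
Qed.

(** Both products are regrouped by the degree carried by the operators alone, leaving the rest to
    [x] and [y]. The resulting coefficients, [phimu] and [muphi], differ by the defect. *)
Lemma ext_lin_bilin Phi mu x y : linear_fps Phi -> bilinear_fps mu ->
  ext_lin Phi (ext_bilin mu x y)
  = ext_bilin (const_fps (mu 0%N)) (ext_lin Phi x) (ext_lin Phi y)
    + ext_bilin (defect Phi mu) x y.
Proof.
move=> Phi_lin mu_bilin.
pose phimu : fps (A -> A -> A) :=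
  fun n a b => \sum_(i < n.+1) Phi i (mu (n - i)%N a b).
pose muphi : fps (A -> A -> A) :=
  fun n a b => \sum_(i < n.+1) mu 0%N (Phi i a) (Phi (n - i)%N b).
have E1 : ext_lin Phi (ext_bilin mu x y) = ext_bilin phimu x y.
  apply/funext => N; rewrite /ext_lin /ext_bilin.
  pose F p i := \sum_(j < (N - (p + i)).+1)
    Phi p (mu i (x j) (y (N - (p + i) - j)%N)).
  transitivity (\sum_(p < N.+1) \sum_(i < (N - p).+1) F p i).
    apply: eq_bigr => p _; rewrite linear_fun_sum //; apply: eq_bigr => i _.
    by rewrite linear_fun_sum // /F subnDA.
  rewrite sum_triangle; apply: eq_bigr => k _; rewrite exchange_big /=.
  by apply: eq_bigr => p _; rewrite /F subnKC ?leq_ord.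
have E2 : ext_bilin (const_fps (mu 0%N)) (ext_lin Phi x) (ext_lin Phi y)
    = ext_bilin muphi x y.
  apply/funext => N; rewrite ext_bilin_constE /ext_lin /ext_bilin.
  (* Here [p] and [q] are the degrees taken from the two copies of [Phi], [i] is the degree in [x],
     and [y] takes the remainder. The sum is first split along [p + i], then [i] and [q] are
     exchanged, and finally it is grouped by [p + q]. *)
  pose G p i q := mu 0%N (Phi p (x i)) (Phi q (y (N - p - i - q)%N)).
  transitivity (\sum_(p < N.+1) \sum_(i < (N - p).+1)
      \sum_(q < (N - p - i).+1) G p i q).
    rewrite (sum_triangle (fun p i => \sum_(q < (N - p - i).+1) G p i q)).
    apply: eq_bigr => j _; rewrite (linear_fun_sum ((mu_bilin 0%N).1 _)).
    apply: eq_bigr => p _; rewrite (linear_fun_sum ((mu_bilin 0%N).2 _)).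
    by rewrite /G -subnDA subnKC ?leq_ord.
  transitivity (\sum_(p < N.+1) \sum_(q < (N - p).+1)
      \sum_(i < (N - p - q).+1) G p i q).
    by apply: eq_bigr => p _; rewrite (sum_triangle_swap (fun i q => G p i q)).
  rewrite (sum_triangle (fun p q => \sum_(i < (N - p - q).+1) G p i q)).
  apply: eq_bigr => k _; rewrite exchange_big /=.
  apply: eq_bigr => p _; rewrite -subnDA subnKC ?leq_ord //.
  apply: eq_bigr => i _; rewrite /G; congr (mu _ _ (Phi _ (y _))).
  by rewrite -!subnDA addnCA subnKC ?leq_ord // addnC.
rewrite E1 E2; apply/funext => N; rewrite fps_addE; apply/eqP.
rewrite addrC -subr_eq /ext_bilin -sumrB; apply/eqP; apply: eq_bigr => i _.
by rewrite -sumrB; apply: eq_bigr.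
Qed.

End PowerSeries.

(** * The defect of multiplicativity and its lowest-order term *)

Section Defect.
Variables (K : fieldType) (A : lmodType K) (alpha : A -> A) (Phi : fps (A -> A)).
Hypotheses (alpha_lin : linear alpha) (Phi_lin : linear_fps Phi).
Hypothesis Phi_alpha : forall i a, Phi i (alpha a) = alpha (Phi i a).
Implicit Types mu nu : fps (A -> A -> A).

Lemma defectD mu nu : bilinear_fps mu -> bilinear_fps nu ->
  defect Phi (mu + nu) = defect Phi mu + defect Phi nu.
Proof.
move=> mu_bilin nu_bilin; apply/funext => n; apply/funext => a; apply/funext => b.
rewrite fps_addE !fctE /defect addrACA -opprD -!big_split /=; congr (_ - _).
by apply: eq_bigr => i _; rewrite -?linear_fun_add.
Qed.

Lemma bilinear_defect mu : bilinear_fps mu -> bilinear_fps (defect Phi mu).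
Proof.
move=> mu_bilin n; split=> u; apply: linear_sub_fun; apply: linear_sum_fun => i c v w.
- by rewrite (mu_bilin _).1 Phi_lin.
- by rewrite Phi_lin (mu_bilin _).1.
- by rewrite (mu_bilin _).2 Phi_lin.
- by rewrite Phi_lin (mu_bilin _).2.
Qed.

Lemma alpha_defect mu : (forall i a b, alpha (mu i a b) = mu i (alpha a) (alpha b)) ->
  forall n a b, alpha (defect Phi mu n a b) = defect Phi mu n (alpha a) (alpha b).
Proof.
move=> mu_alpha n a b; rewrite /defect.
have -> (u v : A) : alpha (u - v) = alpha u - alpha v.
  by rewrite -!scaleN1r linear_fun_add // -[_ *: v]addr0 alpha_lin linear_fun0 // addr0.
rewrite !(linear_fun_sum alpha_lin); congr (_ - _); apply: eq_bigr => i _.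
  by rewrite -Phi_alpha mu_alpha.
by rewrite mu_alpha !Phi_alpha.
Qed.

(** For [n > 0] the coefficient of index [n] meets degree [n] only in the extreme terms of the two
    sums, where its partner is [mu 0] or [Phi 0 = id]. Filling the empty slot with [phi] thus
    subtracts the coboundary of [phi]. *)
Lemma defect_update mu n (phi : A -> A) : (0 < n)%N -> Phi 0%N = id ->
  bilinear_fps mu -> Phi n = (fun=> 0) ->
  forall a b, defect (update Phi n phi) mu n a b
    = defect Phi mu n a b
      - (mu 0%N (phi a) b + mu 0%N a (phi b) - phi (mu 0%N a b)).
Proof.
case: n => // n _ Phi0 mu_bilin Phin0 a b.
have lt_neq (i : 'I_n) : (n - i == n.+1)%N = false.
  by rewrite ltn_eqF // ltnS leq_subr.
have upd_lt (i : 'I_n) : update Phi n.+1 phi i.+1 = Phi i.+1.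
  by rewrite /update eqSS ltn_eqF.
have upd_rev (i : 'I_n) : update Phi n.+1 phi (n - i)%N = Phi (n - i)%N.
  by rewrite /update lt_neq.
have updn : update Phi n.+1 phi n.+1 = phi by rewrite /update eqxx.
have upd0 : update Phi n.+1 phi 0%N = id by rewrite /update.
have sum1 : \sum_(i < n) update Phi n.+1 phi i.+1 (mu (n - i)%N a b)
    = \sum_(i < n) Phi i.+1 (mu (n - i)%N a b).
  by apply: eq_bigr => i _; rewrite upd_lt.
have sum2 : \sum_(i < n) mu 0%N (update Phi n.+1 phi i.+1 a)
      (update Phi n.+1 phi (n - i)%N b)
    = \sum_(i < n) mu 0%N (Phi i.+1 a) (Phi (n - i)%N b).
  by apply: eq_bigr => i _; rewrite upd_lt upd_rev.
rewrite /defect !(big_ord_recr n.+1) !(big_ord_recl n) /= !subnn !subn0.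
rewrite sum1 sum2.
rewrite upd0 updn Phi0 Phin0 (linear_fun0 ((mu_bilin 0%N).1 _)).
rewrite (linear_fun0 ((mu_bilin 0%N).2 _)) !addr0 add0r.
set s1 := \sum_(i < n) Phi i.+1 _; set s2 := \sum_(i < n) mu 0%N (Phi i.+1 _) _.
by rewrite !opprD opprK !addrA [LHS](ACl (1*2*5*6*4*3)%AC).
Qed.

(* The lowest-order term of the defect satisfies the linearization of any
   relation shared by the deformed and the undeformed operations: apply Phi to
   the deformed relation and read off the coefficient of t^n. *)
Lemma defect_hom_assoc (mu1 mu2 mu3 mu4 : fps (A -> A -> A)) n :
    bilinear_fps mu1 -> bilinear_fps mu2 -> bilinear_fps mu3 -> bilinear_fps mu4 ->
    Phi 0%N = id ->
    (forall k, (k < n)%N -> defect Phi mu1 k = fun _ _ => 0) ->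
    (forall k, (k < n)%N -> defect Phi mu2 k = fun _ _ => 0) ->
    (forall k, (k < n)%N -> defect Phi mu3 k = fun _ _ => 0) ->
    (forall k, (k < n)%N -> defect Phi mu4 k = fun _ _ => 0) ->
    (forall x y z,
       ext_bilin mu1 (ext_bilin mu2 x y) (ext_const alpha z)
       = ext_bilin mu3 (ext_const alpha x) (ext_bilin mu4 y z)) ->
    (forall a b c,
       mu1 0%N (mu2 0%N a b) (alpha c) = mu3 0%N (alpha a) (mu4 0%N b c)) ->
  forall a b c,
    mu1 0%N (defect Phi mu2 n a b) (alpha c) + defect Phi mu1 n (mu2 0%N a b) (alpha c)
    = mu3 0%N (alpha a) (defect Phi mu4 n b c)
      + defect Phi mu3 n (alpha a) (mu4 0%N b c).
Proof.
move=> bil1 bil2 bil3 bil4 Phi0 d1 d2 d3 d4 ext_assoc assoc a b c.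
have ext0 x : ext_lin Phi x 0%N = x 0%N by rewrite /ext_lin big_ord1 Phi0.
have := congr1 (fun u => ext_lin Phi u n)
  (ext_assoc (fps_const a) (fps_const b) (fps_const c)).
rewrite !ext_lin_bilin // ext_bilin_constDl // ext_bilin_constDr //.
(* The defect-free terms on the two sides agree by the undeformed relation applied to the images
   under [ext_lin Phi], so they cancel; two terms with one defect each remain on either side. *)
rewrite !ext_lin_const // (ext_const_hom_assoc _ _ _ (bil1 0%N) (bil3 0%N) assoc).
rewrite !fps_addE -!addrA => /addrI.
rewrite ext_bilin_const_leadingl //; last exact: ext_bilin_lt.
rewrite ext_bilin_const_leadingr //; last exact: ext_bilin_lt.
by rewrite !ext_bilin_leading // /ext_const !ext0.
Qed.

End Defect.

(** * Cochains, cocycles and coboundaries in degrees one and two *)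

Section LowDegreeCohomology.
Variables (K : fieldType) (A : lmodType K) (alpha : A -> A).
Variables (prec succ : A -> A -> A).

Lemma pi_cmap_delta0 (u v : A -> A -> A) a :
  pi_cmap u v (delta_mx 0 ord0 : 'rV[K]_2) a = u (a ord0) (a ord_max).
Proof. by rewrite /pi_cmap !mxE /= scale1r scale0r addr0. Qed.

Lemma pi_cmap_delta1 (u v : A -> A -> A) a :
  pi_cmap u v (delta_mx 0 ord_max : 'rV[K]_2) a = v (a ord0) (a ord_max).
Proof. by rewrite /pi_cmap !mxE /= scale1r scale0r add0r. Qed.

Lemma pi_cmap_sum (u v : A -> A -> A) a :
  pi_cmap u v (\sum_(s < 2) delta_mx 0 s : 'rV[K]_2) a
  = u (a ord0) (a ord_max) + v (a ord0) (a ord_max).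
Proof.
by rewrite /pi_cmap !summxE !big_ord_recl !big_ord0 !mxE /= !addr0 add0r !scale1r.
Qed.

Lemma multilinear_pi_cmap (u v : A -> A -> A) :
  bilinear_for *:%R *:%R u -> bilinear_for *:%R *:%R v ->
  multilinear_cmap (@pi_cmap K A u v).
Proof.
move=> u_bilin v_bilin; split=> [a c e e'|e a j c x y].
  by rewrite /pi_cmap !mxE !scalerDl !scalerDr !scalerA addrACA.
rewrite /pi_cmap !ffunE; have [->|->] : j = ord0 \/ j = ord_max.
- by case: j => -[|[|//]] ?; [left|right]; apply: val_inj.
- rewrite /= u_bilin.1 v_bilin.1 !scalerDr !scalerA ![_ * c]mulrC -!scalerA.
  by rewrite addrACA.
- rewrite /= u_bilin.2 v_bilin.2 !scalerDr !scalerA ![_ * c]mulrC -!scalerA.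
  by rewrite addrACA.
Qed.

Lemma sum_ord3 (F : 'I_3 -> A) :
  \sum_(r < 3) F r = F (inord 0) + F (inord 1) + F (inord 2).
Proof.
rewrite 3!big_ord_recl big_ord0 addr0 addrA.
by congr (F _ + F _ + F _); apply: val_inj; rewrite /= inordK.
Qed.

(** The inner block occupies the inputs 0 and 1. Basis elements 0 and 1 lie in the block, select
    [u'] or [v'], and give the outer index 0; basis element 2 lies outside, where [Ri] is the sum of
    the basis and produces [u' + v']. *)
Lemma circ_pi_cmap0 (u v u' v' : A -> A -> A) (e : 'rV[K]_3)
    (a : {ffun 'I_3 -> A}) :
  let: (a0, a1, a2) := (a (inord 0), a (inord 1), a (inord 2)) in
  circ_i (m := 1) (n := 1) alpha ord0 (pi_cmap u v) (pi_cmap u' v') e a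
  = e 0 (inord 0) *: u (u' a0 a1) (alpha a2)
    + e 0 (inord 1) *: u (v' a0 a1) (alpha a2)
    + e 0 (inord 2) *: v (u' a0 a1 + v' a0 a1) (alpha a2).
Proof.
have I0 : inord 0 = ord0 :> 'I_2 by apply: val_inj; rewrite /= inordK.
have I1 : inord 1 = ord_max :> 'I_2 by apply: val_inj; rewrite /= inordK.
rewrite /circ_i sum_ord3 /R0 /Ri !inordK //= I0 I1.
rewrite !pi_cmap_delta0 !pi_cmap_delta1 !ffunE /=.
by rewrite pi_cmap_sum !ffunE.
Qed.

Lemma circ_pi_cmap1 (u v u' v' : A -> A -> A) (e : 'rV[K]_3)
    (a : {ffun 'I_3 -> A}) :
  let: (a0, a1, a2) := (a (inord 0), a (inord 1), a (inord 2)) in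
  circ_i (m := 1) (n := 1) alpha ord_max (pi_cmap u v) (pi_cmap u' v') e a
  = e 0 (inord 0) *: u (alpha a0) (u' a1 a2 + v' a1 a2)
    + e 0 (inord 1) *: v (alpha a0) (u' a1 a2)
    + e 0 (inord 2) *: v (alpha a0) (v' a1 a2).
Proof.
have I0 : inord 0 = ord0 :> 'I_2 by apply: val_inj; rewrite /= inordK.
have I1 : inord 1 = ord_max :> 'I_2 by apply: val_inj; rewrite /= inordK.
rewrite /circ_i sum_ord3 /R0 /Ri !inordK //= I0 I1.
rewrite !pi_cmap_delta0 !pi_cmap_delta1 !ffunE /=.
by rewrite pi_cmap_sum !ffunE.
Qed.

(** The differential vanishes exactly along the three basis vectors of K[C_3], and each component is
    the linearization of one hom-dendriform axiom. *)
Lemma pi_cmap_cocycle (u v : A -> A -> A) :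
    bilinear_for *:%R *:%R u -> bilinear_for *:%R *:%R v ->
    (forall a b, alpha (u a b) = u (alpha a) (alpha b)) ->
    (forall a b, alpha (v a b) = v (alpha a) (alpha b)) ->
    (forall a b c, prec (u a b) (alpha c) + u (prec a b) (alpha c)
       = prec (alpha a) (u b c + v b c) + u (alpha a) (prec b c + succ b c)) ->
    (forall a b c, prec (v a b) (alpha c) + u (succ a b) (alpha c)
       = succ (alpha a) (u b c) + v (alpha a) (prec b c)) ->
    (forall a b c, succ (u a b + v a b) (alpha c) + v (prec a b + succ a b) (alpha c)
       = succ (alpha a) (v b c) + v (alpha a) (succ b c)) ->
  is_cocycle (n := 2) alpha prec succ (@pi_cmap K A u v).
Proof.
move=> u_bilin v_bilin u_alpha v_alpha rel1 rel2 rel3; split; [split|].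
- exact: multilinear_pi_cmap.
- move=> r a; have [->|->] : r = ord0 \/ r = ord_max.
  + by case: r => -[|[|//]] ?; [left|right]; apply: val_inj.
  + by rewrite !pi_cmap_delta0 !ffunE u_alpha.
  + by rewrite !pi_cmap_delta1 !ffunE v_alpha.
(* The cast is between convertible types, so replacing its proof by [erefl] removes it. In degree
   two its term gets the sign +1, and inside each [circ] the insertion in the second slot gets -1:
   the second-slot insertions form the right-hand sides of the relations. *)
move=> e a; rewrite /differential (eq_irrelevance (addn1 1) erefl) /=.
rewrite expr1 scaleN1r opprK /circ !big_ord_recl !big_ord0 /= !addr0.
have -> : lift ord0 ord0 = ord_max :> 'I_2 by apply: val_inj.
rewrite !mul0n !mul1n expr0 expr1 !scale1r !scaleN1r.
rewrite !circ_pi_cmap0 !circ_pi_cmap1 addrACA -opprD; apply/eqP; rewrite subr_eq0.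
apply/eqP; rewrite !addrA [LHS](ACl (1*4*(2*5)*(3*6))%AC).
rewrite [RHS](ACl (1*4*(2*5)*(3*6))%AC) /=.
by rewrite -!scalerDr rel1 rel2 rel3.
Qed.

Lemma sum_delta n (r : 'I_n) (F : 'I_n -> A) :
  \sum_(s < n) (delta_mx 0 r : 'rV[K]_n) 0 s *: F s = F r.
Proof.
rewrite (bigD1 r) //= mxE !eqxx scale1r big1 ?addr0 // => s /negPf rs.
by rewrite mxE rs andbF scale0r.
Qed.

(** In degree one the differential measures how far [phi] is from being a derivation; [w] stands for
    [prec] or [succ] according to [r], so both are treated at once. *)
Lemma differential1_delta (g : cmap A 1) (phi : A -> A) (r : 'I_2)
    (a : {ffun 'I_2 -> A}) :
    (forall s b, g (delta_mx 0 s) b = phi (b ord0)) ->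
  let w x y := pi_cmap prec succ (delta_mx 0 r : 'rV[K]_2)
                 [ffun k : 'I_2 => if k == ord0 then x else y] in
  differential alpha prec succ g (delta_mx 0 r) a
  = w (phi (a ord0)) (a ord_max) + w (a ord0) (phi (a ord_max))
    - phi (w (a ord0) (a ord_max)).
Proof.
move=> gE w.
have wE x y (b : {ffun 'I_2 -> A}) : b ord0 = x -> b ord_max = y ->
    pi_cmap prec succ (delta_mx 0 r : 'rV[K]_2) b = w x y.
  by rewrite /w /pi_cmap !ffunE /= => -> ->.
have I0 : inord 0 = ord0 :> 'I_2 by apply: val_inj; rewrite /= inordK.
have I1 : inord 1 = ord_max :> 'I_2 by apply: val_inj; rewrite /= inordK.
(* For an inner map of arity one, [R0] is the identity and [Ri] is always the unique basis vector,
   whether or not [s] lies in the block. *)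
have R0E (i s : 'I_2) : R0 (m := 1) (n := 0) i s = s.
  apply: val_inj; rewrite /R0.
  by case: i s => -[|[|//]] ? [[|[|//]] ?]; rewrite /= inordK.
have gRi (i s : 'I_2) b : g (Ri K (m := 1) (n := 0) i s) b = phi (b ord0).
  by rewrite /Ri; case: ifP => _; rewrite ?big_ord1 gE.
have RiE : Ri K (m := 0) (n := 1) ord0 r = delta_mx 0 r.
  by rewrite /Ri /= ltn_ord subn0 inord_val.
rewrite /differential (eq_irrelevance (addn1 0) erefl) /= /circ big_ord1.
rewrite 2!big_ord_recl big_ord0 addr0 !muln0 !mul0n !expr0 !scale1r.
rewrite /circ_i !sum_delta !R0E gE; congr (_ + _ - phi _).
- by apply: wE; rewrite !ffunE /= ?gRi ?ffunE ?addn0 ?I0 ?I1.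
- by apply: wE; rewrite !ffunE /= ?gRi ?ffunE ?addn0 ?I0 ?I1.
- by rewrite ffunE /= RiE; apply: wE; rewrite !ffunE ?addn0 ?I0 ?I1.
Qed.

(** K[C_1] is one-dimensional, so a 1-cochain amounts to one linear map [phi] commuting with
    [alpha]; evaluating on the two basis vectors of K[C_2] gives one equation per operation. *)
Lemma coboundary_pi_cmap (u v : A -> A -> A) :
    is_coboundary (n := 2) alpha prec succ (@pi_cmap K A u v) ->
  exists phi : A -> A, [/\ linear phi,
    forall a, phi (alpha a) = alpha (phi a),
    forall a b, u a b = prec (phi a) b + prec a (phi b) - phi (prec a b) &
    forall a b, v a b = succ (phi a) b + succ a (phi b) - phi (succ a b)].
Proof.
case=> g [[_ g_lin] g_alpha] gE.
pose phi x := g (delta_mx 0 ord0) [ffun=> x].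
have phiE (r : 'I_1) a : g (delta_mx 0 r) a = phi (a ord0).
  by rewrite (ord1 r); congr g; apply/ffunP => k; rewrite ffunE (ord1 k).
exists phi; split.
- move=> c x y; have := g_lin (delta_mx 0 ord0) [ffun=> 0] ord0 c x y.
  by rewrite !phiE !ffunE.
- by move=> a; rewrite /phi g_alpha; congr g; apply/ffunP => k; rewrite !ffunE.
- move=> a b; have := gE (delta_mx 0 ord0)
    [ffun k : 'I_2 => if k == ord0 then a else b].
  by rewrite (differential1_delta _ _ phiE) !pi_cmap_delta0 !ffunE.
- move=> a b; have := gE (delta_mx 0 ord_max)
    [ffun k : 'I_2 => if k == ord0 then a else b].
  by rewrite (differential1_delta _ _ phiE) !pi_cmap_delta1 !ffunE.
Qed.

End LowDegreeCohomology.

(** * The obstruction cocycle and the triviality of deformations *)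

Section DeformationTheory.
Variables (K : fieldType) (A : lmodType K).

Lemma equivalent_deformations_refl (alpha : A -> A)
    (prec_t succ_t : fps (A -> A -> A)) :
  linear alpha -> equivalent_deformations alpha prec_t succ_t prec_t succ_t.
Proof.
move=> alpha_lin; pose Id : fps (A -> A) := fun n => if n is 0 then id else fun=> 0.
have IdE x : ext_lin Id x = x.
  by apply/funext => n; rewrite /ext_lin big_ord_recl subn0 big1 ?addr0.
exists Id; split=> // [[|i]||x y|x y].
- by [].
- by split=> [c x y|a] /=; rewrite ?scaler0 ?addr0 ?linear_fun0.
- by exists id => x; rewrite IdE.
- by rewrite !IdE.
- by rewrite !IdE.
Qed.

Variables (alpha : A -> A) (prec succ : A -> A -> A).
Hypothesis hA : hom_dendriform alpha prec succ.
Variables prec_t succ_t : fps (A -> A -> A).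
Hypothesis hdef : is_deformation alpha prec succ prec_t succ_t.

(** Evaluating on constant series isolates [mu i] as the coefficient of t^i, so multiplicativity
    over K[[t]] descends to each coefficient. *)
Lemma alpha_coefficient (mu : fps (A -> A -> A)) : bilinear_fps mu ->
    (forall x y, ext_const alpha (ext_bilin mu x y)
       = ext_bilin mu (ext_const alpha x) (ext_const alpha y)) ->
  forall i a b, alpha (mu i a b) = mu i (alpha a) (alpha b).
Proof.
move=> mu_bilin ext_alpha i a b; have alpha_lin := hd_alpha_linear hA.
have constE c : ext_const alpha (fps_const c) = fps_const (alpha c).
  by apply/funext => -[|n] //=; rewrite /ext_const /= linear_fun0.
have := congr1 (fun u : fps A => u i) (ext_alpha (fps_const a) (fps_const b)).
by rewrite !constE /ext_const !ext_bilin_fps_const.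
Qed.

(** Each linearized axiom is an instance of [defect_hom_assoc]. The first takes [prec_t + succ_t] as
    [mu4] and the third takes it as [mu2], which is why the defect of the sum is computed first. *)
Lemma defect_cocycle (Phi : fps (A -> A)) n :
    linear_fps Phi -> (forall i a, Phi i (alpha a) = alpha (Phi i a)) ->
    Phi 0%N = id ->
    (forall k, (k < n)%N -> defect Phi prec_t k = fun _ _ => 0) ->
    (forall k, (k < n)%N -> defect Phi succ_t k = fun _ _ => 0) ->
  is_cocycle (n := 2) alpha prec succ
    (@pi_cmap K A (defect Phi prec_t n) (defect Phi succ_t n)).
Proof.
move=> Phi_lin Phi_alpha Phi0 dp ds.
have [p_bilin s_bilin p0 s0 ext_hd] := hdef; have alpha_lin := hd_alpha_linear hA.
have ps_bilin := bilinear_fps_add p_bilin s_bilin.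
have dps k : (k < n)%N -> defect Phi (prec_t + succ_t) k = fun _ _ => 0.
  move=> kn; rewrite defectD // fps_addE dp // ds //.
  by apply/funext => a; apply/funext => b; rewrite !fctE addr0.
have dpsE a b : defect Phi (prec_t + succ_t) n a b
    = defect Phi prec_t n a b + defect Phi succ_t n a b by rewrite defectD.
have ps0 a b : (prec_t + succ_t) 0%N a b = prec a b + succ a b.
  by rewrite fps_addE p0 s0.
apply: pi_cmap_cocycle.
- exact: bilinear_defect.
- exact: bilinear_defect.
- apply: alpha_defect => //; apply: alpha_coefficient => // x y.
  exact: (hd_alpha_prec ext_hd).
- apply: alpha_defect => //; apply: alpha_coefficient => // x y.
  exact: (hd_alpha_succ ext_hd).
- move=> a b c; rewrite -dpsE -ps0 -p0; apply: (defect_hom_assoc alpha_lin) => //.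
    by move=> x y z; rewrite ext_bilinD; apply: (hd_prec_prec ext_hd).
  by move=> x y z; rewrite ps0 p0; apply: (hd_prec_prec hA).
- move=> a b c; rewrite -p0 -s0; apply: (defect_hom_assoc alpha_lin) => //.
    by move=> x y z; apply: (hd_succ_prec ext_hd).
  by move=> x y z; rewrite p0 s0; apply: (hd_succ_prec hA).
- move=> a b c; rewrite -dpsE -ps0 -s0; apply: (defect_hom_assoc alpha_lin) => //.
    by move=> x y z; rewrite ext_bilinD; apply: (hd_succ_succ ext_hd).
  by move=> x y z; rewrite ps0 s0; apply: (hd_succ_succ hA).
Qed.

Hypothesis hH2 : cohomology_eq0 alpha prec succ 2.

Lemma deformation_trivial : trivial_deformation alpha prec succ prec_t succ_t.
Proof.
have [p_bilin s_bilin p0 s0 _] := hdef; have alpha_lin := hd_alpha_linear hA.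
(* [good n] involves only the coefficients up to [n], as [recursive_choice] demands. *)
pose good n (Phi : fps (A -> A)) := [/\ linear (Phi n),
  forall a, Phi n (alpha a) = alpha (Phi n a), Phi 0%N = id,
  defect Phi prec_t n = (fun _ _ => 0) & defect Phi succ_t n = fun _ _ => 0].
have good_local n Phi Psi : (forall k, (k <= n)%N -> Phi k = Psi k) ->
    good n Phi -> good n Psi.
  move=> eqPhi; rewrite /good (eq_defect prec_t eqPhi) (eq_defect succ_t eqPhi).
  by rewrite !eqPhi.
have [|Phi Phi_good] := @recursive_choice _ id good good_local.
  move=> n Psi Psi_good; case: (posnP n) => [->|n_gt0].
    exists id; split=> //; apply/funext => a; apply/funext => b;
      by rewrite /defect !big_ord1 /= subrr.
  (* Nothing is known of [Psi k] for [k >= n]. Cutting it off there makes all coefficients linear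
     and compatible with [alpha], and leaves the slot [Phi n = 0] that [defect_update] fills. *)
  pose Phi : fps (A -> A) := fun k => if (k < n)%N then Psi k else fun=> 0.
  have Phi_good k : (k < n)%N -> good k Phi.
    move=> kn; apply: good_local (Psi_good k kn) => j jk.
    by rewrite /Phi (leq_ltn_trans jk).
  have Phi_lin : linear_fps Phi.
    move=> k; have [/Phi_good[]//|nk] := ltnP k n.
    by rewrite /Phi ltnNge nk => c x y /=; rewrite scaler0 addr0.
  have Phi_alpha k a : Phi k (alpha a) = alpha (Phi k a).
    have [/Phi_good[]//|nk] := ltnP k n.
    by rewrite /Phi ltnNge nk /= linear_fun0.
  have [_ _ Phi0 _ _] := Phi_good 0%N n_gt0.
  have Phin : Phi n = fun=> 0 by rewrite /Phi ltnn.
  have dp k : (k < n)%N -> defect Phi prec_t k = fun _ _ => 0 by case/Phi_good.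
  have ds k : (k < n)%N -> defect Phi succ_t k = fun _ _ => 0 by case/Phi_good.
  have [phi [phi_lin phi_alpha prec_phi succ_phi]] :=
    coboundary_pi_cmap (hH2 (defect_cocycle Phi_lin Phi_alpha Phi0 dp ds)).
  (* [Psi] and its truncation, once updated at [n], agree up to degree [n]. *)
  exists phi; apply: (good_local n (update Phi n phi)) => [k kn|].
    by rewrite /update /Phi; case: eqP => // /eqP kn'; rewrite ltn_neqAle kn' kn.
  have updn : update Phi n phi n = phi by rewrite /update eqxx.
  split; rewrite ?updn //.
  - by rewrite /update eq_sym (gtn_eqF n_gt0).
  - apply/funext => a; apply/funext => b.
    by rewrite defect_update // prec_phi p0 subrr.
  - apply/funext => a; apply/funext => b.
    by rewrite defect_update // succ_phi s0 subrr.
have Phi_lin : linear_fps Phi by move=> n; case: (Phi_good n).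
have [_ _ Phi0 _ _] := Phi_good 0%N.
have ext_bilin_zero (mu : fps (A -> A -> A)) x y :
    (forall n, mu n = fun _ _ => 0) -> ext_bilin mu x y = 0.
  by move=> mu0; apply/funext => n; rewrite ext_bilin_leading ?mu0.
exists Phi; split=> // [n||x y|x y].
- by case: (Phi_good n).
- exact: ext_lin_bijective.
- rewrite ext_lin_bilin // p0 [X in _ + X]ext_bilin_zero ?addr0 //.
  by move=> n; case: (Phi_good n).
- rewrite ext_lin_bilin // s0 [X in _ + X]ext_bilin_zero ?addr0 //.
  by move=> n; case: (Phi_good n).
Qed.

End DeformationTheory.

Theorem theorem4p7 (K : fieldType) (charK0 : [pchar K] =i pred0)
    (A : lmodType K) (alpha : A -> A) (prec succ : A -> A -> A)
    (hA : hom_dendriform alpha prec succ)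
    (hH2 : cohomology_eq0 alpha prec succ 2)
    (prec_t succ_t : fps (A -> A -> A))
    (hdef : is_deformation alpha prec succ prec_t succ_t) :
  exists prec_t' succ_t' : fps (A -> A -> A),
    [/\ is_deformation alpha prec succ prec_t' succ_t',
        trivial_deformation alpha prec succ prec_t' succ_t' &
        equivalent_deformations alpha prec_t succ_t prec_t' succ_t'].
Proof.
exists prec_t, succ_t; split=> //; first exact: deformation_trivial.
exact: equivalent_deformations_refl (hd_alpha_linear hA).
Qed.
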